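(* Let $H$ be a hypergraph with at least one edge and let $p\in(0,1)$. Then $\min\{\lceil p|e|\rceil \mid e\in E(H)\}\leq b_{L,p}(H)$.
   Context: A hypergraph $H=(V(H),E(H))$ has a finite nonempty vertex set and a finite collection $E(H)$ of subsets of $V(H)$ called edges (parallel edges allowed). For a proportion $p\in(0,1)$, the proportion-based propagation rule is: if at some time step at least $\lceil p|e|\rceil$ vertices of an edge $e$ are on fire, then in the next time step all vertices of $e$ catch fire; burned vertices stay burned. A set $S\subseteq V(H)$ is a lazy burning set if, setting all of $S$ on fire at once and then repeatedly applying the propagation rule, every vertex eventually catches fire; $b_{L,p}(H)$ is the minimum size of a lazy burning set. *)

(* Defs.v *)
From mathcomp Require Import all_boot all_order all_algebra.
From mathcomp Require Import boolp reals.

Set Implicit Arguments.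
Unset Strict Implicit.
Unset Printing Implicit Defensive.

Import Order.TTheory GRing.Theory Num.Theory.

Local Open Scope ring_scope.

(* Edges form an indexed family, so distinct indices may carry the same subset
   (parallel edges). Empty edges are not excluded. *)
Record hypergraph := Hypergraph {
  vertex : finType;
  vertex_nonempty : (0 < #|vertex|)%N;
  edge_index : finType;
  edge : edge_index -> {set vertex}
}.

Section LazyBurning.
Variables (R : realType) (p : R) (H : hypergraph).
Implicit Types (e : edge_index H) (B S : {set vertex H}).

Definition threshold e : int := Num.ceil (p * #|edge e|%:R).

Definition burn_step B : {set vertex H} :=
  B :|: \bigcup_(e | threshold e <= #|edge e :&: B|%:Z) edge e.

Definition on_fire S (t : nat) : {set vertex H} := iter t burn_step S.

Definition lazy_burning_set S : Prop :=
  forall v : vertex H, exists t : nat, v \in on_fire S t.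

Definition has_lazy_burning_set_of_size (n : nat) : bool :=
  `[< exists S, lazy_burning_set S /\ #|S| = n >].

Lemma ex_lazy_burning_set : exists n, has_lazy_burning_set_of_size n.
Proof.
exists #|[set: vertex H]|; apply/asboolP; exists [set: vertex H]; split=> //.
by move=> v; exists 0%N; rewrite inE.
Qed.

Definition lazy_burning_number : nat := ex_minn ex_lazy_burning_set.

(* The unit of the iterated minimum is the threshold of an actual edge, so it
   does not affect the value. *)
Definition min_threshold (hE : (0 < #|edge_index H|)%N) : int :=
  \big[Num.min/threshold (enum_val (Ordinal hE))]_(e : edge_index H) threshold e.

End LazyBurning.

(* Main.v *)
(* If [S] is smaller than every threshold, then no edge ever ignites, so the fire
   stays on [S]; a lazy burning [S] would then be the whole vertex set, which
   (as p < 1) is at least as large as any threshold. *)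
Require Import Defs.
From mathcomp Require Import all_boot all_order all_algebra.
From mathcomp Require Import boolp reals.

Set Implicit Arguments.
Unset Strict Implicit.
Unset Printing Implicit Defensive.

Import Order.TTheory GRing.Theory Num.Theory.

Local Open Scope ring_scope.

(** As [#|edge e|] is an integer, it bounds the ceiling as soon as it bounds [p * #|edge e|]. *)
Lemma threshold_le_card (R : realType) (p : R) (H : hypergraph)
    (e : edge_index H) : p <= 1 -> threshold p e <= #|edge e|%:Z.
Proof.
by move=> p1; rewrite /threshold ceil_le_int -pmulrn ler_piMl.
Qed.

Lemma on_fire_below_thresholds (R : realType) (p : R) (H : hypergraph)
    (S : {set vertex H}) (t : nat) :
  (forall e : edge_index H, #|S|%:Z < threshold p e) -> on_fire p S t = S.
Proof.
move=> small; elim: t => //= t ->.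
rewrite /burn_step big_pred0 ?setU0 // => e.
(* An edge meets [S] in at most [#|S|] vertices, too few to reach its threshold. *)
apply/negbTE; rewrite -ltNge; apply: le_lt_trans (small e).
by rewrite lez_nat subset_leq_card ?subsetIr.
Qed.

Theorem theorem2p13 (R : realType) (p : R) (H : hypergraph)
    (hE : (0 < #|edge_index H|)%N) (hp0 : 0 < p) (hp1 : p < 1) :
  min_threshold p hE <= (lazy_burning_number p H)%:Z.
Proof.
rewrite /lazy_burning_number; case: ex_minnP => _ /asboolP[S [burnS <-]] _.
rewrite leNgt; apply/negP => small.
have smallS (e : edge_index H) : #|S|%:Z < threshold p e.
  by apply: lt_le_trans small _; apply: bigmin_le.
have ST : S = setT.
  apply/setP => v; have [t] := burnS v.
  by rewrite on_fire_below_thresholds // inE => ->.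
(* The edge supplied by [hE] would have more than [#|S|] vertices, yet [S] already contains every
   vertex. *)
have := lt_le_trans (smallS (enum_val (Ordinal hE)))
  (threshold_le_card _ (ltW hp1)).
by rewrite ltz_nat ST cardsT ltnNge max_card.
Qed.
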